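(* Let $K$ be an algebraically closed field and let $A$ be a finite dimensional, non-semisimple, connected $K$-algebra that is S-connected, and let $a=\min(\mathcal{O}_A)$. Then for every $c\in\mathcal{O}_A$, $$\operatorname{gldim}(A)\le a+\lambda_c(A).$$
   Context: For a finite dimensional algebra $A$ let $S_1,\dots,S_n$ be representatives of the isomorphism classes of simple $A$-modules. Put $\mathcal{O}_A=\{\operatorname{pdim} S_i \mid 1\le i\le n\}$, where $\operatorname{pdim}$ is projective dimension. For $c\in\mathcal{O}_A$ put $\lambda_c(A)=|\{i \mid \operatorname{pdim}(S_i)\ne c\}|$, the number of (isomorphism classes of) simple $A$-modules with projective dimension not equal to $c$. $A$ is called S-connected if $A$ has finite global dimension and $\mathcal{O}_A$ is an interval in $\mathbb{N}_0$, i.e. every natural number $k$ lying between the projective dimensions of two simple modules is itself the projective dimension of a simple module. $\operatorname{gldim}$ denotes global dimension. *)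

(* Defs.v *)
From HB Require Import structures.
From mathcomp Require Import all_boot all_order all_algebra all_field.
From mathcomp Require Import boolp.

Set Implicit Arguments.
Unset Strict Implicit.
Unset Printing Implicit Defensive.

Import GRing.Theory.
Local Open Scope ring_scope.

(* Modules are left modules, not assumed finitely generated.
   Results for right modules follow by passing to the converse ring A^c. *)

(* Extended natural numbers: None stands for infinity. *)
Definition enat := option nat.

Definition enat_le (x y : enat) : bool :=
  match x, y with
  | _, None => true
  | None, Some _ => false
  | Some m, Some n => (m <= n)%N
  end.

(* Infimum in enat of a set of natural numbers; infinity on the empty set. *)
Definition enat_inf (P : nat -> Prop) : enat :=
  match pselect (exists n, `[< P n >]) with
  | left exP => Some (ex_minn exP)
  | right _ => None
  end.

Section Modules.

Variable A : nzRingType.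

Definition surjective_map (M N : Type) (f : M -> N) : Prop :=
  forall y, exists x, f x = y.

Definition exact_at (L M N : lmodType A) (f : L -> M) (g : M -> N) : Prop :=
  forall x : M, g x = 0 <-> exists y, f y = x.

Definition isomorphic (M N : lmodType A) : Prop :=
  exists f : {linear M -> N}, bijective f.

Definition simple_module (M : lmodType A) : Prop :=
  (exists x : M, x != 0) /\
  (forall U : {pred M}, submod_closed U -> U =i pred1 0 \/ U =i predT).

Definition projective (P : lmodType A) : Prop :=
  forall (M N : lmodType A) (g : {linear M -> N}) (f : {linear P -> N}),
    surjective_map g -> exists h : {linear P -> M}, forall x, g (h x) = f x.

Record proj_resolution (M : lmodType A) := ProjResolution {
  res_obj : nat -> lmodType A;
  res_diff : forall i, {linear res_obj i.+1 -> res_obj i};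
  res_aug : {linear res_obj 0 -> M};
  res_proj : forall i, projective (res_obj i);
  res_aug_surj : surjective_map res_aug;
  res_exact0 : exact_at (res_diff 0) res_aug;
  res_exact : forall i, exact_at (res_diff i.+1) (res_diff i)
}.

Definition has_resolution_of_length (M : lmodType A) (n : nat) : Prop :=
  exists R : proj_resolution M,
    forall i, (n < i)%N -> forall x : res_obj R i, x = 0.

(* With this convention the zero module has projective dimension 0. *)
Definition pdim (M : lmodType A) : enat := enat_inf (has_resolution_of_length M).

(* The supremum of pdim M over all modules M, as a least upper bound. *)
Definition gldim : enat :=
  enat_inf (fun n => forall M : lmodType A, enat_le (pdim M) (Some n)).

(* M is the direct sum of finitely many simple modules, each element being
   uniquely a sum of images of elements t i; for the regular module of a ring
   finite sums are no restriction. *)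
Definition fin_semisimple_module (M : lmodType A) : Prop :=
  exists (m : nat) (T : 'I_m -> lmodType A) (iota : forall i, {linear T i -> M}),
    (forall i, simple_module (T i)) /\
    bijective (fun t : {dffun forall i, T i} => \sum_i iota i (t i)).

Definition semisimple_ring : Prop := fin_semisimple_module A^o.

Definition simple_representatives (n : nat) (S : 'I_n -> lmodType A) : Prop :=
  [/\ forall i, simple_module (S i),
      forall i j, isomorphic (S i) (S j) -> i = j
    & forall M : lmodType A, simple_module M -> exists i, isomorphic M (S i)].

(* The finite values of pdim on the family S; these are all the values as soon
   as gldim is finite. *)
Definition pdim_set (n : nat) (S : 'I_n -> lmodType A) (k : nat) : Prop :=
  exists i, pdim (S i) = Some k.

Definition lambda (n : nat) (S : 'I_n -> lmodType A) (c : nat) : nat :=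
  #|[pred i | pdim (S i) != Some c]|.

Definition S_connected (n : nat) (S : 'I_n -> lmodType A) : Prop :=
  gldim <> None /\
  (forall i j k : nat, pdim_set S i -> pdim_set S j ->
     (i <= k <= j)%N -> pdim_set S k).

End Modules.

(* Objects of falgType K are nonzero, so both factors are nontrivial. *)
Definition connected_algebra (K : fieldType) (A : falgType K) : Prop :=
  ~ exists (B C : falgType K) (f : {lrmorphism A -> (B * C)%type}), bijective f.

Definition is_min (O : nat -> Prop) (a : nat) : Prop :=
  O a /\ forall k, O k -> (a <= k)%N.

(* Main.v *)
Require Import Defs.
From HB Require Import structures.
From mathcomp Require Import all_boot all_order all_algebra all_field.
From mathcomp Require Import boolp classical_sets functions.

(** The theorem combines a counting argument with the inequality
    [gldim A <= d], where [d] is the largest projective dimension of a simple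
    module.

    Counting: the values of [pdim] on the simple modules fill the interval from
    [a] to [d], and [c] is one of them.  Each of the [d - a] values other than
    [c] is taken by some simple module, so [d - a <= lambda S c]
    ([interval_card]).

    The inequality has to be shown for all modules, finitely generated or not.
    The route taken here avoids the radical and infinite direct sums; it moves
    the question to injective modules.  Over a finite dimensional algebra a
    module [N] is injective as soon as Ext^1(T, N) = 0 for all simple [T]: by
    Baer's criterion ([baer_criterion]) only maps from left ideals have to be
    extended, and they extend along a finite chain of left ideals with simple
    quotients ([ideal_extension_of_simples]).  Every module embeds in an
    injective one, the coinduced module Hom_K(A, N)
    ([coinduced_ideal_extension], [coinduced_embedding]), so each [N] has a
    [d]-th cosyzygy [N'], with Ext^(k+d+1)(M, N) = 0 if and only if
    Ext^(k+1)(M, N') = 0 for all [M] and [k] ([cosyzygy]).  If all simple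
    modules have projective dimension at most [d], then
    Ext^1(T, N') = Ext^(d+1)(T, N) = 0 for simple [T], hence [N'] is injective,
    hence Ext^(d+1)(M, N) = Ext^1(M, N') = 0 for every [M].  When this holds for
    all [N], a projective resolution of [M] can be cut off at step [d]
    ([truncate_resolution]).  That resolutions exist at all follows from the
    finiteness of the global dimension. *)

Set Implicit Arguments.
Unset Strict Implicit.
Unset Printing Implicit Defensive.

Import GRing.Theory.
Local Open Scope ring_scope.

(** * Linear maps and quotient modules *)

Section LinearMaps.
Variable R : nzRingType.
Implicit Types X Y Z M : lmodType R.

Definition submodule M (U : M -> Prop) : Prop :=
  U 0 /\ forall (r : R) x y, U x -> U y -> U (r *: x + y).

Lemma linear_of_function X Y (h : X -> Y) :
  (forall r x x', h (r *: x + x') = r *: h x + h x') ->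
  exists f : {linear X -> Y}, f =1 h.
Proof.
move=> hlin; pose hL := GRing.isLinear.Build R X Y *:%R h hlin.
by exists (HB.pack h hL : {linear X -> Y}).
Qed.

Lemma linear_of_graph X Y (G : X -> Y -> Prop) :
  (forall x, exists y, G x y) ->
  (forall x y y', G x y -> G x y' -> y = y') ->
  (forall r x y x' y', G x y -> G x' y' -> G (r *: x + x') (r *: y + y')) ->
  exists h : {linear X -> Y}, forall x, G x (h x).
Proof.
move=> /choice[h Gh] Guniq Glin.
have [|f fE] := @linear_of_function X Y h; last by exists f => x; rewrite fE.
by move=> r x x'; apply: Guniq (Gh _) _; apply: Glin.
Qed.

Lemma factor_surjection X Y Z (p : {linear X -> Y}) (f : {linear X -> Z}) :
  surjective_map p -> (forall x, p x = 0 -> f x = 0) ->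
  exists h : {linear Y -> Z}, forall x, h (p x) = f x.
Proof.
move=> p_surj kerf.
have f_eq x x' : p x = p x' -> f x = f x'.
  by move=> pE; apply/eqP; rewrite -subr_eq0 -linearB kerf // linearB pE subrr.
have [| | |h hG] :=
    @linear_of_graph Y Z (fun y z => exists2 x, p x = y & f x = z).
- by move=> y; have [x <-] := p_surj y; exists (f x), x.
- by move=> y z z' [x <- <-] [x' /esym/f_eq -> <-].
- move=> r y z y' z' [x <- <-] [x' <- <-]; exists (r *: x + x');
  by rewrite linearP.
by exists h => x; have [x' /f_eq -> ->] := hG (p x).
Qed.

Lemma factor_injection X Y Z (i : {linear Y -> Z}) (f : {linear X -> Z}) :
  injective i -> (forall x, exists y, i y = f x) ->
  exists h : {linear X -> Y}, forall x, i (h x) = f x.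
Proof.
move=> i_inj imf; apply: (@linear_of_graph X Y (fun x y => i y = f x)) => //.
- by move=> x y y' <- /i_inj.
- by move=> r x y x' y' iy iy'; rewrite !linearP iy iy'.
Qed.

End LinearMaps.

Section Quotient.
Variables (R : nzRingType) (M : lmodType R) (U : zmodClosed M).
Hypothesis scaleU : forall (r : R) x, x \in U -> r *: x \in U.

(** The proof of stability under scaling is an argument of the type, so that the
    module structure below can be inferred from the type alone. *)
Definition module_quotient of (forall (r : R) x, x \in U -> r *: x \in U) :=
  Quotient.quot U.
HB.instance Definition _ := GRing.Zmodule.on (module_quotient scaleU).

Local Notation Q := (module_quotient scaleU).
Local Open Scope quotient_scope.

Definition quotient_scale (r : R) : Q -> Q :=
  lift_op1 Q (GRing.scale r).

Lemma pi_quotient_scale r : {morph \pi_Q : x / r *: x >-> quotient_scale r x}.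
Proof.
move=> x; unlock quotient_scale; apply/eqP; rewrite -Quotient.idealrBE.
by rewrite -scalerBr scaleU // Quotient.idealrBE reprK.
Qed.

Fact quotient_scaleA r s v :
  quotient_scale r (quotient_scale s v) = quotient_scale (r * s) v.
Proof. by elim/quotW: v => x; rewrite -!pi_quotient_scale scalerA. Qed.

Fact quotient_scale1 : left_id 1 quotient_scale.
Proof. by elim/quotW => x; rewrite -pi_quotient_scale scale1r. Qed.

Fact quotient_scaleDr : right_distributive quotient_scale +%R.
Proof.
by move=> r; elim/quotW=> x; elim/quotW=> y;
  rewrite -!raddfD /= -!pi_quotient_scale -raddfD scalerDr.
Qed.

Fact quotient_scaleDl v : {morph quotient_scale^~ v : r s / r + s}.
Proof.
by move=> r s; elim/quotW: v => x; rewrite -!pi_quotient_scale scalerDl raddfD.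
Qed.

HB.instance Definition _ := GRing.Zmodule_isLmodule.Build R Q
  quotient_scaleA quotient_scale1 quotient_scaleDr quotient_scaleDl.
End Quotient.

Lemma quotient_exists (R : nzRingType) (M : lmodType R) (U : M -> Prop) :
  submodule U ->
  exists (Q : lmodType R) (p : {linear M -> Q}),
    surjective_map p /\ forall x, p x = 0 <-> U x.
Proof.
move=> [U0 Ulin]; pose V : {pred M} := fun x => `[<U x>].
have Vclosed : submod_closed V.
  by split=> [|r x y /asboolP Ux /asboolP Uy]; apply/asboolP; auto.
pose VC := GRing.isZmodClosed.Build M V (GRing.submod_closedB Vclosed).
pose W : zmodClosed M := HB.pack V VC.
have WZ (r : R) x : x \in W -> r *: x \in W.
  by move=> /asboolP Ux; apply/asboolP; rewrite -[_ *: _]addr0; apply: Ulin.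
pose Q : lmodType R := module_quotient WZ.
have [|p pE] := @linear_of_function R M Q (\pi_Q)%qT.
  by move=> r x y; rewrite raddfD /= pi_quotient_scale.
exists Q, p; split=> [|x].
  by elim/quotW => x; exists x.
rewrite pE -[0](raddf0 \pi_Q%qT); split.
  by move/eqP; rewrite -Quotient.idealrBE subr0 => /asboolP.
by move=> Ux; apply/eqP; rewrite -Quotient.idealrBE subr0; apply/asboolP.
Qed.

Lemma image_submodule (R : nzRingType) (M N : lmodType R)
    (f : {linear M -> N}) :
  submodule (fun y => exists x, f x = y).
Proof.
split=> [|r _ _ [x <-] [x' <-]]; first by exists 0; rewrite linear0.
by exists (r *: x + x'); rewrite linearP.
Qed.

(** * Baer's criterion *)

Section Baer.
Local Open Scope classical_set_scope.
Variable R : nzRingType.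

(** Extension of [g] along [u] when [g] vanishes on the kernel of [u]; for
    injective [u] this is the usual definition.  The general form spares the
    passage to the image of [u]. *)
Definition injective_module (I : lmodType R) : Prop :=
  forall (X Y : lmodType R) (u : {linear X -> Y}) (g : {linear X -> I}),
    (forall x, u x = 0 -> g x = 0) ->
    exists h : {linear Y -> I}, forall x, h (u x) = g x.

(** A linear map to [N] from the left ideal [L], given as a total function whose
    values outside [L] are arbitrary. *)
Definition partial_linear (N : lmodType R) (L : R -> Prop) (phi : R -> N) :=
  L 0 /\ forall r x y, L x -> L y ->
    L (r * x + y) /\ phi (r * x + y) = r *: phi x + phi y.

Lemma partial_linear_domain (N : lmodType R) L (phi : R -> N) :
  partial_linear L phi -> @submodule R R^o L.
Proof. by move=> [L0 Llin]; split=> // r x y Lx Ly; case: (Llin r x y). Qed.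

Lemma partial_linearM (N : lmodType R) L (phi : R -> N) :
  partial_linear L phi ->
  forall r x, L x -> L (r * x) /\ phi (r * x) = r *: phi x.
Proof.
move=> [L0 Llin] r x Lx; have phi0 : phi 0 = 0.
  have [_] := Llin 1 0 0 L0 L0; rewrite mul1r addr0 scale1r.
  by move/(canLR (addrK _)); rewrite subrr.
by have [] := Llin r x 0 Lx L0; rewrite !addr0 phi0 addr0.
Qed.

Definition ideal_extension (N : lmodType R) : Prop :=
  forall (L : R -> Prop) (phi : R -> N), partial_linear L phi ->
    exists n, forall x, L x -> phi x = x *: n.

(** Zorn's lemma gives a maximal partial extension, encoded by its graph.  If it
    is not defined at [y], the map [r |-> value at r *: y] on a left ideal is
    multiplication by some [n0], and setting the value at [y] to [n0] extends
    further. *)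
Lemma baer_criterion (N : lmodType R) : ideal_extension N -> injective_module N.
Proof.
move=> ext X Y u g kerg.
pose G0 : set (Y * N) := [set (u x, g x) | x in setT].
(* The union of an empty chain is empty, so the empty set must count as good. *)
pose good (G : set (Y * N)) :=
  [/\ forall r y n y' n', G (y, n) -> G (y', n') -> G (r *: y + y', r *: n + n'),
      forall n, G (0, n) -> n = 0 & forall p, G p -> G0 `<=` G].
have [|G [[Glin G0inj Gsup] Gmax]] := @Zorn_bigcup _ good.
- move=> F goodF totF; split.
  + move=> r y n y' n' [H FH Hy] [H' FH' Hy'].
    have [HH'|H'H] := totF _ _ FH FH'.
      by exists H' => //; have [+ _ _] := goodF _ FH'; apply=> //; apply: HH'.
    by exists H => //; have [+ _ _] := goodF _ FH; apply=> //; apply: H'H.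
  + by move=> n [H FH Hn]; have [_ + _] := goodF _ FH; apply.
  + move=> p [H FH Hp] q G0q; exists H => //.
    by have [_ _ /(_ p Hp)] := goodF _ FH; apply.
have G0G : G0 `<=` G.
  have [G_empty|/eqP/set0P[p /Gsup]//] := pselect (G = set0).
  exfalso; apply: (Gmax G0).
    rewrite G_empty; split=> // /(_ (u 0, g 0)) H.
    by apply: H; exists 0.
  split=> [r y n y' n' [x _ [<- <-]] [x' _ [<- <-]]|n [x _ [/kerg gx0 <-]]|p _].
  - by exists (r *: x + x') => //; rewrite !linearP.
  - by [].
  - by [].
have GG x : G (u x, g x) by apply: G0G; exists x.
have G00 : G (0, 0) by have := GG 0; rewrite !linear0.
have Guniq y n n' : G (y, n) -> G (y, n') -> n = n'.
  move=> Gn Gn'; have := Glin (-1) _ _ _ _ Gn Gn'.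
  by rewrite !scaleN1r addNr => /G0inj/eqP; rewrite addrC subr_eq0 => /eqP.
have Gtot y : exists n, G (y, n).
  apply: contrapT => noy.
  have [n0 n0P] : exists n, forall r m, G (r *: y, m) -> m = r *: n.
    pose L r := exists m, G (r *: y, m).
    have /choice[phi phiP] r : exists m, L r -> G (r *: y, m).
      by have [[m]|] := pselect (L r); [exists m | exists 0].
    have [|n nP] := ext L phi.
      split=> [|r x x' Lx Lx']; first by exists 0; rewrite scale0r.
      have GL : G ((r * x + x') *: y, r *: phi x + phi x').
        by rewrite scalerDl -scalerA; apply: Glin; apply: phiP.
      have LL : L (r * x + x') by eexists; exact: GL.
      by split=> //; apply: Guniq GL; apply: phiP.
    exists n => r m Gm; rewrite -nP; last by exists m.
    by apply: (Guniq _ _ _ Gm); apply: phiP; exists m.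
  pose G' : set (Y * N) :=
    [set p | exists z m r, G (z, m) /\ p = (z + r *: y, m + r *: n0)].
  apply: (Gmax G'); first split.
  - by move=> [z m] Gzm; exists z, m, 0; rewrite !scale0r !addr0.
  - move=> /(_ (y, n0)) H; apply: noy; exists n0; apply: H.
    by exists 0, 0, 1; rewrite !scale1r !add0r.
  split.
  - move=> r z m z' m' [y1 [m1 [r1 [G1 [-> ->]]]]] [y2 [m2 [r2 [G2 [-> ->]]]]].
    exists (r *: y1 + y2), (r *: m1 + m2), (r * r1 + r2); split; first exact: Glin.
    by rewrite !scalerDr !scalerDl !scalerA; congr pair; exact: addrACA.
  - move=> n [z [m [r [Gzm [/esym/eqP zE ->]]]]].
    have {}zE : (- r) *: y = z.
      by move: zE; rewrite addr_eq0 scaleNr => /eqP ->.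
    by move: Gzm; rewrite -zE => /n0P ->; rewrite scaleNr addNr.
  - move=> _ _ q /G0G; case: q => z m Gzm.
    by exists z, m, 0; rewrite !scale0r !addr0.
have [h hG] : exists h : {linear Y -> N}, forall y, G (y, h y).
  exact: (@linear_of_graph _ Y N (fun y n => G (y, n))).
by exists h => x; apply: Guniq (hG _) (GG x).
Qed.

End Baer.

(** * Enough injective modules *)

(** The subspaces contained in [P] have bounded dimension, and one of largest
    dimension is all of [P]. *)
Lemma vspace_of_submodule (K : fieldType) (V : vectType K) (P : V -> Prop) :
  submodule P -> exists U : {vspace V}, forall x, x \in U <-> P x.
Proof.
move=> [P0 Plin].
pose sub_of (m : nat) := `[< exists U : {vspace V},
  (forall x, x \in U -> P x) /\ \dim U = m >].
have ex_sub : exists m, sub_of m.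
  exists 0%N; apply/asboolP; exists 0%VS; rewrite dimv0; split=> // x.
  by rewrite memv0 => /eqP ->.
have sub_le m : sub_of m -> (m <= \dim {:V})%N.
  by move=> /asboolP[U [_ <-]]; apply/dimvS/subvf.
case: (ex_maxnP ex_sub sub_le) => m /asboolP[U [UP dimU]] maxm.
exists U => x; split=> [/UP//|Px]; apply: contrapT => /negP xU.
have /maxm : sub_of (\dim (U + <[x]>)).
  apply/asboolP; exists (U + <[x]>)%VS; split=> // y.
  by case/memv_addP=> u /UP Pu [_ /vlineP[k ->] ->]; rewrite addrC; apply: Plin.
rewrite -dimU (geq_leqif (dimv_leqif_sup (addvSl _ _))) => /subvP sU.
by apply: (negP xU); apply: sU; apply: (subvP (addvSr _ _)); apply: memv_line.
Qed.

Lemma vspace_of_left_ideal (K : fieldType) (A : falgType K) (L : A -> Prop) :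
  @submodule A A^o L -> exists V : {vspace A}, forall x, x \in V <-> L x.
Proof.
move=> [L0 Llin]; apply: vspace_of_submodule; split=> // k x y Lx Ly.
by rewrite -mulr_algl; apply: (Llin k%:A x y).
Qed.

Section Coinduced.
Variables (K : fieldType) (A : falgType K) (N : lmodType A).

Definition scalar_linear : {pred A -> N} := fun f =>
  `[< forall k x y, f (k *: x + y) = k%:A *: f x + f y >].

Fact scalar_linear_closed : zmod_closed scalar_linear.
Proof.
split=> [|f g /asboolP fL /asboolP gL]; apply/asboolP => k x y.
  by rewrite /= scaler0 addr0.
by rewrite /= !fctE fL gL scalerBr opprD addrACA.
Qed.
HB.instance Definition _ := GRing.isZmodClosed.Build _ scalar_linear
  scalar_linear_closed.

(** Hom_K(A, N). *)
Definition coinduced := {f : A -> N | f \in scalar_linear}.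
HB.instance Definition _ := SubChoice.on coinduced.
HB.instance Definition _ := [SubChoice_isSubZmodule of coinduced by <:].

Lemma coinducedP (f : coinduced) k x y :
  val f (k *: x + y) = k%:A *: val f x + val f y.
Proof. by case: f => f /= /asboolP. Qed.

Lemma coinduced0 (f : coinduced) : val f 0 = 0.
Proof.
have := coinducedP f 1 0 0; rewrite !scale1r addr0.
by move/(canLR (addrK _)); rewrite subrr.
Qed.

Fact coinduced_scale_subproof a (f : coinduced) :
  (fun x => val f (x * a)) \in scalar_linear.
Proof.
by apply/asboolP => k x y; rewrite mulrDl -scalerAl coinducedP.
Qed.

Definition coinduced_scale a f : coinduced :=
  exist _ (fun x => val f (x * a)) (coinduced_scale_subproof a f).

Fact coinduced_scaleA a b f :
  coinduced_scale a (coinduced_scale b f) = coinduced_scale (a * b) f.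
Proof. by apply/val_inj/funext => x /=; rewrite mulrA. Qed.

Fact coinduced_scale1 : left_id 1 coinduced_scale.
Proof. by move=> f; apply/val_inj/funext => x /=; rewrite mulr1. Qed.

Fact coinduced_scaleDr : right_distributive coinduced_scale +%R.
Proof. by move=> a f g; apply/val_inj/funext. Qed.

Fact coinduced_scaleDl f : {morph coinduced_scale^~ f : a b / a + b}.
Proof.
move=> a b; apply/val_inj/funext => x /=.
by rewrite mulrDr -[x * a]scale1r coinducedP scale1r !scale1r.
Qed.

HB.instance Definition _ := GRing.Zmodule_isLmodule.Build A coinduced
  coinduced_scaleA coinduced_scale1 coinduced_scaleDr coinduced_scaleDl.

(** A complement of [L] in the vector space [A] provides the extension. *)
Lemma coinduced_ext (L : {vspace A}) (phi : A -> N) :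
  (forall k x y, x \in L -> y \in L ->
     phi (k *: x + y) = k%:A *: phi x + phi y) ->
  exists f : coinduced, forall x, x \in L -> val f x = phi x.
Proof.
move=> phiL; have fL : (fun x => phi (projv L x)) \in scalar_linear.
  by apply/asboolP => k x y; rewrite linearP phiL ?memv_proj.
by exists (exist _ (fun x => phi (projv L x)) fL) => x xL /=; rewrite projv_id.
Qed.

(** A module map [phi] from [L] to Hom_K(A, N) is determined by the [K]-linear
    map [x |-> phi x 1] from [L] to [N] (adjunction), and the latter extends to
    [A]. *)
Lemma coinduced_ideal_extension : ideal_extension coinduced.
Proof.
move=> L phi Lphi; have LM := partial_linearM Lphi.
have [V VE] := vspace_of_left_ideal (partial_linear_domain Lphi).
have [|n nP] := @coinduced_ext V (fun x => val (phi x) 1).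
  move=> k x y /VE Lx /VE Ly; rewrite -[k *: x]mulr_algl.
  have [_ ->] := Lphi.2 k%:A x y Lx Ly.
  rewrite -[LHS]/(val (phi x) (1 * k%:A) + val (phi y) 1) mul1r.
  by rewrite -[in LHS](addr0 k%:A) coinducedP coinduced0 addr0.
exists n => x Lx; apply/val_inj/funext => y /=; have [Lyx phiyx] := LM y x Lx.
by rewrite nP; [rewrite phiyx /= mul1r | apply/VE].
Qed.

Lemma coinduced_embedding : exists i : {linear N -> coinduced}, injective i.
Proof.
have iL n : (fun x : A => x *: n) \in scalar_linear.
  by apply/asboolP => k x y; rewrite scalerDl scalerA mulr_algl.
have [|i iE] := @linear_of_function A N coinduced
    (fun n => exist _ (fun x => x *: n) (iL n)).
  move=> r x y; apply/val_inj/funext => a /=.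
  by rewrite [RHS]/= scalerDr scalerA.
exists i => x y; rewrite !iE => /(congr1 (fun f => val f 1)) /=.
by rewrite !scale1r.
Qed.

Lemma enough_injectives :
  exists (I N1 : lmodType A) (i : {linear N -> I}) (p : {linear I -> N1}),
    [/\ ideal_extension I, injective i, surjective_map p & exact_at i p].
Proof.
have [i i_inj] := coinduced_embedding.
have [N1 [p [p_surj kerp]]] := quotient_exists (image_submodule i).
by exists coinduced, N1, i, p; split=> //; apply: coinduced_ideal_extension.
Qed.

End Coinduced.

(** * Projective resolutions *)

Section Resolutions.
Variable R : nzRingType.
Implicit Types M N P : lmodType R.

Lemma res_diffK M (S : proj_resolution M) i x :
  res_diff S i (res_diff S i.+1 x) = 0.
Proof. by apply/res_exact; exists x. Qed.

Lemma projective_retract P M (e : {linear P -> M}) (s : {linear M -> P}) :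
  cancel s e -> projective P -> projective M.
Proof.
move=> sK projP X Y g f g_surj.
have [h hE] := projP X Y g (f \o e) g_surj.
by exists (h \o s) => x /=; rewrite hE /= sK.
Qed.

Let zero_module : lmodType R := 'rV[R]_0.

Lemma zero_moduleE (x : zero_module) : x = 0.
Proof. exact: thinmx0. Qed.

Lemma projective_zero : projective zero_module.
Proof.
move=> X Y g f _; exists (\0 : {linear zero_module -> X}) => x /=.
by rewrite (zero_moduleE x) !linear0.
Qed.

Lemma projective_resolution M : projective M -> has_resolution_of_length M 0.
Proof.
move=> projM.
pose obj i := if i is 0 then M else zero_module.
pose diff i : {linear obj i.+1 -> obj i} := \0.
have obj_proj i : projective (obj i).
  by case: i => // i; apply: projective_zero.
have exact0 : exact_at (diff 0) (idfun : {linear obj 0 -> M}).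
  by move=> x; split=> [/= ->|[y <-//]]; exists 0.
have exactS i : exact_at (diff i.+1) (diff i).
  by move=> x; split=> // _; exists 0; rewrite (zero_moduleE x).
have aug_surj : surjective_map (idfun : {linear obj 0 -> M}).
  by move=> x; exists x.
exists (ProjResolution obj_proj aug_surj exact0 exactS) => -[//|i] _ x.
exact: zero_moduleE.
Qed.

Lemma resolution_cons P M M1 (e : {linear P -> M}) (j : {linear M1 -> P}) n :
  projective P -> surjective_map e -> injective j -> exact_at j e ->
  has_resolution_of_length M1 n -> has_resolution_of_length M n.+1.
Proof.
move=> projP e_surj j_inj je [S Sn].
pose obj i := if i is i'.+1 then res_obj S i' else P.
pose diff i : {linear obj i.+1 -> obj i} :=
  match i return {linear obj i.+1 -> obj i} with
  | 0 => j \o res_aug S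
  | i'.+1 => res_diff S i'
  end.
have obj_proj i : projective (obj i) by case: i => // i; apply: res_proj.
have exact0 : exact_at (diff 0) (e : {linear obj 0 -> M}).
  move=> x; split=> [/je[y <-]|[y <-]]; last by apply/je; exists (res_aug S y).
  by have [z <-] := res_aug_surj S y; exists z.
have exactS i : exact_at (diff i.+1) (diff i).
  case: i => [|i]; last exact: res_exact.
  move=> x; split=> [/= jx0|/res_exact0 /= ->]; last exact: linear0.
  by apply/res_exact0/j_inj; rewrite jx0 linear0.
have aug_surj : surjective_map (e : {linear obj 0 -> M}) by [].
by exists (ProjResolution obj_proj aug_surj exact0 exactS) => -[//|i] /Sn.
Qed.

Lemma resolution_iso M N n :
  isomorphic M N -> has_resolution_of_length N n -> has_resolution_of_length M n.
Proof.
move=> [f f_bij] [S Sn]; have f_inj := bij_inj f_bij.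
have f_surj : surjective_map f.
  by have [g _ fK] := f_bij => y; exists (g y).
have [|e eK] := @factor_surjection _ _ _ _ f (idfun : {linear M -> M}) f_surj.
  by move=> x fx0; apply: f_inj; rewrite fx0 linear0.
have e_inj : injective e.
  move=> x y; have [x' <-] := f_surj x; have [y' <-] := f_surj y.
  by rewrite !eK /= => ->.
have aug_surj : surjective_map (e \o res_aug S : {linear _ -> _}).
  by move=> x; have [z zE] := res_aug_surj S (f x); exists z; rewrite /= zE eK.
have exact0 : exact_at (res_diff S 0) (e \o res_aug S : {linear _ -> _}).
  move=> x; split=> [/= ex0|/res_exact0 /= ->]; last exact: linear0.
  by apply/res_exact0/e_inj; rewrite ex0 linear0.
by exists (ProjResolution (@res_proj _ _ S) aug_surj exact0 (@res_exact _ _ S)).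
Qed.

(** Ext^(k+1)(M, N) = 0, computed from [S]: exactness of Hom(S, N) at place
    [k.+1]. *)
Definition ext_vanishes M (S : proj_resolution M) (k : nat) N : Prop :=
  forall g : {linear res_obj S k.+1 -> N},
    (forall x, g (res_diff S k.+1 x) = 0) ->
    exists h : {linear res_obj S k -> N}, forall x, h (res_diff S k x) = g x.

(** The [d]-th syzygy is projective: Ext^(d+1) vanishes with the next syzygy as
    coefficients, so the latter is a direct summand of [res_obj S d].  The
    induction replaces [M] by its first syzygy and [S] by its shift. *)
Lemma truncate_resolution d M (S : proj_resolution M) :
  (forall N, ext_vanishes S d N) -> has_resolution_of_length M d.
Proof.
elim: d M S => [|d IHd] M S ext0.
  have [N [q [q_surj kerq]]] := quotient_exists (image_submodule (res_diff S 1)).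
  have [|h hE] := ext0 N q; first by move=> x; apply/kerq; exists x.
  have [|t tE] := factor_surjection q_surj (f := res_diff S 0).
    by move=> x /kerq[y <-]; apply: res_diffK.
  (* [t \o h] projects onto the first syzygy, so the complementary projection
     induces a section of the augmentation. *)
  have [|s sE] := factor_surjection (res_aug_surj S)
      (f := (idfun \- (t \o h) : {linear res_obj S 0 -> res_obj S 0})).
    by move=> _ /res_exact0[y <-] /=; rewrite hE tE subrr.
  apply: projective_resolution.
  apply: (projective_retract (e := res_aug S) (s := s)).
    move=> m; have [x <-] := res_aug_surj S m; rewrite sE /= raddfB /=.
    have [y <-] := q_surj (h x); rewrite tE.
    suff -> : res_aug S (res_diff S 0 y) = 0 by rewrite subr0.
    by apply/res_exact0; exists y.
  exact: res_proj.
have [|M1 [q [q_surj kerq]]] := @quotient_exists R (res_obj S 1)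
    (fun x => res_diff S 0 x = 0).
  split=> [|r x y x0 y0]; first exact: linear0.
  by rewrite linearP x0 y0 scaler0 addr0.
have [|j jE] := factor_surjection q_surj (f := res_diff S 0).
  by move=> x /kerq.
have j_inj : injective j.
  move=> x y; have [x' <-] := q_surj x; have [y' <-] := q_surj y.
  rewrite !jE => /eqP; rewrite -subr_eq0 -linearB => /eqP/kerq.
  by rewrite linearB => /eqP; rewrite subr_eq0 => /eqP.
have exact_j : exact_at j (res_aug S).
  move=> x; split=> [/res_exact0[y <-]|[y <-]]; first by exists (q y); rewrite jE.
  by have [z <-] := q_surj y; rewrite jE; apply/res_exact0; exists z.
have exact_q : exact_at (res_diff S 1) q.
  by move=> x; split=> [/kerq/res_exact//|/res_exact/kerq].
pose S1 := @ProjResolution R M1 (fun i => res_obj S i.+1)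
  (fun i => res_diff S i.+1) q (fun i => @res_proj _ _ S i.+1) q_surj exact_q
  (fun i => @res_exact _ _ S i.+1).
apply: (resolution_cons (@res_proj _ _ S 0) (res_aug_surj S) j_inj exact_j).
exact: (IHd _ S1).
Qed.

End Resolutions.

(** * Dimension shifting in the second variable *)

Section Shift.
Variables (R : nzRingType) (N I N1 : lmodType R).
Variables (i : {linear N -> I}) (p : {linear I -> N1}).
Hypotheses (i_inj : injective i) (p_surj : surjective_map p).
Hypothesis ip : exact_at i p.

Let pi0 n : p (i n) = 0. Proof. by apply/ip; exists n. Qed.

(** Maps killing the image of [res_diff S k] are the maps from the [k]-th syzygy;
    when Ext^1 of this syzygy with coefficients in [N] vanishes, they lift along
    [p]. *)
Lemma ext_vanishes_lift M (S : proj_resolution M) k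
    (f : {linear res_obj S k -> N1}) :
  ext_vanishes S k N -> (forall x, f (res_diff S k x) = 0) ->
  exists f' : {linear res_obj S k -> I},
    (forall x, p (f' x) = f x) /\ forall x, f' (res_diff S k x) = 0.
Proof.
move=> ext0 fd0; have [f1 f1E] := res_proj f p_surj.
have [|t tE] := factor_injection (f := f1 \o res_diff S k) i_inj.
  by move=> x; apply/ip; rewrite /= f1E fd0.
have [|h hE] := ext0 t.
  by move=> x; apply: i_inj; rewrite tE /= res_diffK !linear0.
exists (f1 \- (i \o h)); split=> x /=; first by rewrite linearB /= pi0 subr0 f1E.
by rewrite hE tE subrr.
Qed.

Lemma hom_lift M (S : proj_resolution M) (f : {linear M -> N1}) :
  ext_vanishes S 0 N -> exists f' : {linear M -> I}, forall x, p (f' x) = f x.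
Proof.
move=> ext0; have augd x : res_aug S (res_diff S 0 x) = 0.
  by apply/res_exact0; exists x.
have [|f1 [f1E f1d0]] := ext_vanishes_lift (f := f \o res_aug S) ext0.
  by move=> x /=; rewrite augd linear0.
have [|f' f'E] := factor_surjection (res_aug_surj S) (f := f1).
  by move=> _ /res_exact0[x <-].
exists f' => x; have [z <-] := res_aug_surj S x; by rewrite f'E f1E.
Qed.

Hypothesis injI : injective_module I.

(** Both sides say that every map from the [k.+1]-st syzygy to [N1] lifts to [I]:
    such a map lifts if and only if it extends to [res_obj S k], because [I] is
    injective and [res_obj S k] is projective. *)
Lemma ext_vanishes_shift M (S : proj_resolution M) k :
  ext_vanishes S k.+1 N <-> ext_vanishes S k N1.
Proof.
split=> ext0 g gd0.
  have [f' [pf' f'd0]] := ext_vanishes_lift ext0 gd0.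
  have [|h hE] := injI (u := res_diff S k) (g := f').
    by move=> x /res_exact[y <-].
  by exists (p \o h) => x /=; rewrite hE.
have [|q qE] := injI (u := res_diff S k.+1) (g := i \o g).
  by move=> x /res_exact[y <-] /=; rewrite gd0 linear0.
have [|h hE] := ext0 (p \o q) => [x|] /=; first by rewrite qE pi0.
have [h' h'E] := res_proj h p_surj.
have [|t tE] := factor_injection
    (f := (q \- (h' \o res_diff S k) : {linear _ -> _})) i_inj.
  by move=> x; apply/ip; rewrite linearB /= h'E hE subrr.
by exists t => x; apply: i_inj; rewrite tE /= res_diffK linear0 subr0 qE.
Qed.

End Shift.

Lemma cosyzygy (K : fieldType) (A : falgType K) d (N : lmodType A) :
  exists N' : lmodType A, forall (M : lmodType A) (S : proj_resolution M) k,
    ext_vanishes S (k + d)%N N <-> ext_vanishes S k N'.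
Proof.
elim: d N => [|d IHd] N; first by exists N => M S k; rewrite addn0.
have [I [N1 [i [p [injI i_inj p_surj ip]]]]] := enough_injectives N.
have [N' N'E] := IHd N1; exists N' => M S k.
rewrite -N'E addnS; apply: (ext_vanishes_shift i_inj p_surj ip).
exact: baer_criterion.
Qed.

(** * Injectivity is detected by simple modules *)

(** The left ideal [L + R b]. *)
Definition ideal_adjoin (R : nzRingType) (L : R -> Prop) (b z : R) : Prop :=
  exists a v, L v /\ z = a * b + v.

Lemma ideal_adjoin_submodule (R : nzRingType) (L : R -> Prop) (b : R) :
  @submodule R R^o L -> @submodule R R^o (ideal_adjoin L b).
Proof.
move=> [L0 Llin]; split; first by exists 0, 0; rewrite mul0r addr0.
move=> r _ _ [a [v [Lv ->]]] [a' [v' [Lv' ->]]].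
exists (r * a + a'), (r * v + v'); split; first exact: Llin.
by rewrite -[_ *: _]/(r * _) mulrDr mulrDl mulrA addrACA.
Qed.

(** A map [phi] on [L] and a value [y] at [b] glue to a map on [L + R b] when
    they agree on the intersection of [L] and [R b]. *)
Lemma partial_linear_adjoin (R : nzRingType) (N : lmodType R) L (phi : R -> N)
    b y :
  partial_linear L phi -> (forall r, L (r * b) -> phi (r * b) = r *: y) ->
  exists psi, partial_linear (ideal_adjoin L b) psi /\
    forall x, L x -> psi x = phi x.
Proof.
move=> Lphi phiy; have [L0 Llin] := Lphi.
have psi_uniq a v a' v' : L v -> L v' -> a * b + v = a' * b + v' ->
    a *: y + phi v = a' *: y + phi v'.
  move=> Lv Lv' /eqP; rewrite -subr_eq0 opprD addrACA -mulrBl addr_eq0 opprB.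
  move=> /eqP vE.
  have Lab : L ((a - a') * b).
    by rewrite vE addrC -mulN1r; exact: (Llin (-1) _ _ Lv Lv').1.
  have := phiy _ Lab; rewrite vE addrC -mulN1r (Llin (-1) _ _ Lv Lv').2.
  rewrite scaleN1r addrC => E; apply/eqP.
  by rewrite -subr_eq0 opprD addrACA -scalerBl -E -[phi v - _]opprB subrr.
have /choice[psi psiP] z : exists w, forall a v, L v -> z = a * b + v ->
    w = a *: y + phi v.
  have [[a [v [Lv ->]]]|noz] := pselect (ideal_adjoin L b z).
    by exists (a *: y + phi v) => a' v' Lv' E; apply: psi_uniq.
  by exists 0 => a v Lv E; case: noz; exists a, v.
have psiE a v : L v -> psi (a * b + v) = a *: y + phi v.
  by move=> Lv; apply: psiP.
exists psi; split; last first.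
  by move=> x Lx; have := psiE 0 x Lx; rewrite mul0r scale0r !add0r.
have [adj0 adjlin] := ideal_adjoin_submodule b (partial_linear_domain Lphi).
split=> // r z z' Lz Lz'; split; first exact: (adjlin r z z').
case: Lz Lz' => [a [v [Lv ->]]] [a' [v' [Lv' ->]]].
have [Lvv phivv] := Llin r v v' Lv Lv'.
have -> : r * (a * b + v) + (a' * b + v') = (r * a + a') * b + (r * v + v').
  by rewrite mulrDr mulrDl mulrA addrACA.
by rewrite !psiE // phivv scalerDl scalerDr scalerA addrACA.
Qed.

(** Take [b] outside [L] with [L + A b] of least dimension.  If [c * b] is not in
    [L], then [L + A c b = L + A b], which puts [b] in [L + A c b]. *)
Lemma minimal_adjoin (K : fieldType) (A : falgType K) (L : A -> Prop) :
  @submodule A A^o L -> (exists x, ~ L x) ->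
  exists b, ~ L b /\ forall c, ~ L (c * b) -> exists a, L ((1 - a * c) * b).
Proof.
move=> subL [b0 Lb0]; have [L0 Llin] := subL.
have adjoin b : exists W : {vspace A}, forall z, z \in W <-> ideal_adjoin L b z.
  exact/vspace_of_left_ideal/ideal_adjoin_submodule.
pose dims m := `[< exists b (W : {vspace A}),
  [/\ ~ L b, forall z, z \in W <-> ideal_adjoin L b z & \dim W = m] >].
have ex_dims : exists m, dims m.
  by have [W WE] := adjoin b0; exists (\dim W); apply/asboolP; exists b0, W.
case: (ex_minnP ex_dims) => m /asboolP[b [W [Lb WE dimW]]] minm.
exists b; split=> // c Lcb; have [W' W'E] := adjoin (c * b).
have W'W : (W' <= W)%VS.
  apply/subvP => z /W'E[a [v [Lv ->]]]; apply/WE.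
  by exists (a * c), v; rewrite mulrA.
have /subvP/(_ b) bW : (W <= W')%VS.
  rewrite -(geq_leqif (dimv_leqif_sup W'W)) dimW; apply: minm.
  by apply/asboolP; exists (c * b), W'.
have /bW/W'E[a [v [Lv bE]]] : b \in W.
  by apply/WE; exists 1, 0; rewrite mul1r addr0.
exists a; rewrite mulrBl mul1r -mulrA {1}bE addrC addKr; exact: Lv.
Qed.

(** The hypothesis on [b] makes [{r | L (r * b)}] a maximal left ideal, so [T] is
    [A] modulo a maximal left ideal, a copy of [(L + A b) / L]. *)
Lemma simple_quotient (R : nzRingType) (L : R -> Prop) (b : R) :
  @submodule R R^o L -> ~ L b ->
  (forall c, ~ L (c * b) -> exists a, L ((1 - a * c) * b)) ->
  exists (T : lmodType R) (q : {linear R^o -> T}),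
    [/\ simple_module T, surjective_map q & forall r, q r = 0 <-> L (r * b)].
Proof.
move=> [L0 Llin] Lb bmin.
have [|T [q [q_surj kerq]]] := @quotient_exists R R^o (fun r => L (r * b)).
  split=> [|r x y Lx Ly]; first by rewrite mul0r.
  by rewrite mulrDl -mulrA; apply: Llin.
exists T, q; split=> //; split.
  by exists (q 1); apply/eqP => /kerq; rewrite mul1r.
move=> U [U0 Ulin].
have [[t [Ut t0]]|noU] := pselect (exists t, t \in U /\ t != 0); last first.
  left=> t; rewrite inE; apply/idP/eqP => [Ut|->//].
  by apply: contrapT => /eqP t0; apply: noU; exists t.
right=> s; have [c cE] := q_surj t; have [r <-] := q_surj s.
have [|a La] := bmin c.
  by move=> /kerq; rewrite cE => /eqP; apply/negP.
have qa : q 1 = a *: t.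
  by apply/eqP; rewrite -cE -linearZ -subr_eq0 -linearB; apply/eqP/kerq.
have -> : q r = r *: q 1 by rewrite -linearZ /= [r *: _]mulr1.
by rewrite qa scalerA -[_ *: _]addr0; apply: Ulin.
Qed.

(** Induction on the codimension of the left ideal [L] on which a map [phi] to
    [N] is given.  Adjoin [b] such that [(L + A b) / L] is simple.  In [I], the
    map [phi] is multiplication by some [n0]; modulo [N] this gives a map from
    the simple quotient to [N1].  Subtracting a lift of that map to [I] corrects
    the value [b *: n0] at [b] to a value in [N]. *)
Lemma ideal_extension_of_simples (K : fieldType) (A : falgType K)
    (N I N1 : lmodType A) (i : {linear N -> I}) (p : {linear I -> N1}) :
  injective i -> exact_at i p -> ideal_extension I ->
  (forall T : lmodType A, simple_module T -> forall f : {linear T -> N1},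
     exists f' : {linear T -> I}, forall x, p (f' x) = f x) ->
  ideal_extension N.
Proof.
move=> i_inj ip injI liftT.
have pi0 n : p (i n) = 0 by apply/ip; exists n.
have ext_full (L : A -> Prop) (phi : A -> N) :
    partial_linear L phi -> (forall x, L x) ->
    exists n, forall x, L x -> phi x = x *: n.
  move=> Lphi Lfull; exists (phi 1) => x _; rewrite -[in LHS](mulr1 x).
  by have [] := partial_linearM Lphi x (Lfull 1).
suff ext m (V : {vspace A}) L (phi : A -> N) : (\dim {:A} - \dim V <= m)%N ->
    (forall x, x \in V <-> L x) -> partial_linear L phi ->
    exists n, forall x, L x -> phi x = x *: n.
  move=> L phi Lphi.
  have [V VE] := vspace_of_left_ideal (partial_linear_domain Lphi).
  exact: ext (leqnn _) VE Lphi.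
elim: m V L phi => [|m IHm] V L phi dimV VE Lphi.
  apply: ext_full => // x; apply/VE.
  suff -> : V = fullv by rewrite memvf.
  apply/eqP; rewrite -(dimv_leqif_eq (subvf V)) eqn_leq dimvS ?subvf //=.
  by rewrite -subn_eq0 -leqn0.
have [Lfull|/existsNP Lproper] := pselect (forall x, L x); first exact: ext_full.
have subL := partial_linear_domain Lphi.
have [b [Lb bmin]] := minimal_adjoin subL Lproper.
have [T [q [simT q_surj kerq]]] := simple_quotient subL Lb bmin.
have [|n0 n0E] := injI L (i \o phi).
  split=> [|r x y Lx Ly]; first exact: subL.1.
  have [Lxy phiE] := Lphi.2 r x y Lx Ly.
  by split=> //=; rewrite phiE linearP.
have [|theta thetaE] :=
    @linear_of_function A A^o N1 (fun r => p (r *: (b *: n0))).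
  by move=> r x y; rewrite scalerDl linearD -scalerA linearZ.
have [|f fE] := factor_surjection q_surj (f := theta).
  by move=> r /kerq Lrb; rewrite thetaE scalerA -n0E //= pi0.
have [f' f'E] := liftT T simT f.
have [y yE] : exists y, i y = b *: n0 - f' (q 1).
  by apply/ip; rewrite linearB /= f'E fE thetaE scale1r subrr.
have phiy r : L (r * b) -> phi (r * b) = r *: y.
  have qM : q r = r *: q 1 by rewrite -linearZ /= [r *: _]mulr1.
  move=> Lrb; apply: i_inj; rewrite linearZ /= yE scalerBr scalerA -n0E //=.
  by rewrite -linearZ -qM /= (kerq r).2 // linear0 subr0.
have [psi [psiL psiE]] := partial_linear_adjoin Lphi phiy.
have [W WE] := vspace_of_left_ideal (partial_linear_domain psiL).
have [|n nE] := IHm W _ psi _ WE psiL.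
  have VW : (V <= W)%VS.
    apply/subvP => v /VE Lv; apply/WE.
    by exists 0, v; rewrite mul0r add0r.
  have dimVW : (\dim V < \dim W)%N.
    rewrite ltn_neqAle dimvS // andbT (dimv_leqif_eq VW).
    apply/eqP => VWE; apply/Lb/VE; rewrite VWE; apply/WE.
    by exists 1, 0; split; [exact: subL.1 | rewrite mul1r addr0].
  rewrite -ltnS; apply: leq_trans dimV.
  by rewrite ltn_sub2l // (leq_trans dimVW) ?dimvS ?subvf.
exists n => x Lx; rewrite -psiE // nE //.
by exists 0, x; rewrite mul0r add0r.
Qed.

(** * Global dimension and simple modules *)

(** Modules of arbitrary size are reached because the injective cosyzygy kills
    Ext^1 with every module in the first variable, while its injectivity was
    tested on simple modules only. *)
Lemma resolution_length_of_simples (K : fieldType) (A : falgType K) d :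
  (forall M : lmodType A, inhabited (proj_resolution M)) ->
  (forall T : lmodType A, simple_module T -> has_resolution_of_length T d) ->
  forall M : lmodType A, has_resolution_of_length M d.
Proof.
move=> resM simd M; have [S] := resM M.
apply: (truncate_resolution (S := S)) => N.
have [N' N'E] := cosyzygy d N; apply/(N'E _ S 0).
have [I [N1 [i [p [injI i_inj p_surj ip]]]]] := enough_injectives N'.
have injN' : injective_module N'.
  apply: baer_criterion.
  apply: (ideal_extension_of_simples i_inj ip injI) => T simT f.
  have [S' S'd] := simd T simT; apply: (hom_lift (S := S') i_inj p_surj ip).
  apply/(N'E _ S' 0) => g gd0; exists \0 => x /=.
  by rewrite (S'd _ (ltnSn d) x) linear0.
move=> g gd0; apply: injN' => x /res_exact[y <-]; exact: gd0.
Qed.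

Lemma enat_inf_le (P : nat -> Prop) n : P n -> enat_le (enat_inf P) (Some n).
Proof.
move=> Pn; rewrite /enat_inf; case: pselect => [exP|[]]; last first.
  by exists n; apply/asboolP.
by case: ex_minnP => m _ minm; apply: minm; apply/asboolP.
Qed.

Lemma enat_inf_someP (P : nat -> Prop) n : enat_inf P = Some n -> P n.
Proof.
rewrite /enat_inf; case: pselect => // exP [<-].
by case: ex_minnP => m /asboolP.
Qed.

Lemma interval_card (I : finType) (v : I -> nat) (a d c : nat) :
  (a <= c <= d)%N -> (forall k, (a <= k <= d)%N -> exists i, v i = k) ->
  (d - a <= #|[pred i | v i != c]|)%N.
Proof.
move=> acd hit; have ad : (a <= d)%N by case/andP: acd => /leq_trans; apply.
have s_uniq : uniq (rem c (iota a (d - a).+1)) by rewrite rem_uniq ?iota_uniq.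
have <- : size (rem c (iota a (d - a).+1)) = (d - a)%N.
  by rewrite size_rem ?size_iota // mem_iota addnS ltnS subnKC.
rewrite -(size_image v); apply: uniq_leq_size s_uniq _ => k.
rewrite mem_rem_uniq ?iota_uniq // => /andP[kc].
rewrite mem_iota addnS ltnS subnKC // => /hit[i vi].
by rewrite -vi; apply: fintype.image_f; rewrite inE vi.
Qed.

Theorem theorem2p7 (K : closedFieldType) (A : falgType K)
  (n : nat) (S : 'I_n -> lmodType A) (a : nat) :
  simple_representatives S ->
  ~ semisimple_ring A ->
  connected_algebra A ->
  S_connected S ->
  is_min (pdim_set S) a ->
  forall c : nat, pdim_set S c ->
    enat_le (gldim A) (Some (a + lambda S c)%N).
Proof.
move=> [_ _ S_rep] _ _ [gldim_fin interval] [Oa a_min] c Oc.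
have [g gldimE] : exists g, gldim A = Some g.
  by case: (gldim A) gldim_fin => // g _; exists g.
have pdim_fin (M : lmodType A) : exists k, pdim M = Some k.
  have := enat_inf_someP gldimE M; by case: (pdim M) => // k _; exists k.
have /choice[pd pdE] i := pdim_fin (S i).
have [i0 _] := Oa.
have [imax _ maxP] := @arg_maxnP _ i0 predT pd isT.
pose d := pd imax.
have le_d k : pdim_set S k -> (k <= d)%N.
  by move=> [i]; rewrite pdE => -[<-]; apply: maxP.
have gldim_le : enat_le (gldim A) (Some d).
  apply: enat_inf_le => M; apply: enat_inf_le.
  apply: resolution_length_of_simples => [{}M|T simT].
    by have [k /enat_inf_someP[R _]] := pdim_fin M.
  have [i Ti] := S_rep T simT; apply: resolution_iso Ti _.
  have [R Rk] := enat_inf_someP (pdE i); exists R => j dj; apply: Rk.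
  by apply: leq_trans dj; rewrite ltnS; apply: maxP.
have lambdaE : lambda S c = #|[pred i | pd i != c]|.
  by apply: eq_card => i; rewrite !inE pdE.
suff card : (d - a <= lambda S c)%N.
  case: (gldim A) gldim_le => //= m /leq_trans; apply.
  by rewrite -leq_subLR.
rewrite lambdaE; apply: interval_card; first by rewrite a_min ?le_d.
move=> k akd; have [|i] := interval a d k Oa _ akd; first by exists imax.
by rewrite pdE => -[<-]; exists i.
Qed.
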